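(* Let $X\in\mathbf{R}^{m\times n}$ be nonzero and $\beta\in(0,1]$. Given a precision target $\epsilon>0$, construct a random matrix $S\in\mathbf{R}^{m\times s}$ by subsampling the columns of $X$ (as described in the context). Let $\eta=1+\sqrt{8\log(1/\beta)}$ and $$s=\eta^2\,\frac{\|X\|_2^2}{\epsilon^2}\,\mathrm{NumRank}(X)^2 .$$ Then $$\mathbf{E}\big[\,\big|\|S\|_2-\|X\|_2\big|\,\big]\le\epsilon$$ and $$\big|\|S\|_2-\|X\|_2\big|\le\epsilon$$ with probability at least $1-\beta$.
   Context: $\|\cdot\|_2$ is the spectral norm, $\|\cdot\|_F$ the Frobenius norm, $X^{(i)}$ the $i$-th column of $X$, and $\mathrm{NumRank}(X)=\|X\|_F^2/\|X\|_2^2$ the numerical rank. Column subsampling with sampling rate $s$ (a positive integer, $1\le s<n$): set $q_i=\|X^{(i)}\|_2^2/\|X\|_F^2$ for $i=1,\dots,n$; draw independent indices $j_1,\dots,j_s\in\{1,\dots,n\}$ with $\mathbf{P}(j_t=l)=q_l$; the matrix $S\in\mathbf{R}^{m\times s}$ has columns $S^{(t)}=X^{(j_t)}/\sqrt{s\,q_{j_t}}$, $t=1,\dots,s$. *)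

(* Defs.v *)
From HB Require Import structures.
From mathcomp Require Import all_boot all_order all_algebra.
From mathcomp Require Import all_classical all_reals all_analysis.
Import Order.TTheory GRing.Theory Num.Theory.
Import numFieldNormedType.Exports.

Set Implicit Arguments.
Unset Strict Implicit.
Unset Printing Implicit Defensive.

Local Open Scope classical_set_scope.
Local Open Scope ring_scope.

(* The library's canonical norm on matrices is the entrywise maximum, hence the
   Euclidean, spectral and Frobenius norms below. *)
Definition l2norm (R : realType) (n : nat) (v : 'cV[R]_n) : R :=
  Num.sqrt (\sum_(i < n) v i 0 ^+ 2).

Definition frobenius_norm (R : realType) (m n : nat) (A : 'M[R]_(m, n)) : R :=
  Num.sqrt (\sum_(i < m) \sum_(j < n) A i j ^+ 2).

Definition spectral_norm (R : realType) (m n : nat) (A : 'M[R]_(m, n)) : R :=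
  sup [set l2norm (A *m v) | v in [set v : 'cV[R]_n | l2norm v <= 1]].

Definition num_rank (R : realType) (m n : nat) (A : 'M[R]_(m, n)) : R :=
  frobenius_norm A ^+ 2 / spectral_norm A ^+ 2.

(* Random elements of the finite set 'I_n with its discrete sigma-algebra: 'I_0
   is not pointed, so 'I_n is not a measurableType.  As 'I_n is finite, it is
   enough to require the preimages of singletons to be measurable. *)
Definition measurable_index d (T : measurableType d) (n : nat)
    (k : T -> 'I_n) : Prop :=
  forall l : 'I_n, measurable (k @^-1` [set l]).

Definition mutually_independent d (T : measurableType d) (R : realType)
    (P : probability T R) (s n : nat) (j : 'I_s -> T -> 'I_n) : Prop :=
  forall (J : {set 'I_s}) (B : 'I_s -> set 'I_n),
    P (\bigcap_(t in [set` J]) (j t @^-1` B t)) =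
    (\prod_(t in J) P (j t @^-1` B t))%E.

Definition column_prob (R : realType) (m n : nat) (X : 'M[R]_(m, n))
    (l : 'I_n) : R :=
  l2norm (col l X) ^+ 2 / frobenius_norm X ^+ 2.

Definition column_sampling d (T : measurableType d) (R : realType)
    (P : probability T R) (m n s : nat) (X : 'M[R]_(m, n))
    (j : 'I_s -> T -> 'I_n) : Prop :=
  [/\ forall t : 'I_s, measurable_index (j t),
      mutually_independent P j
    & forall (t : 'I_s) (l : 'I_n),
        P (j t @^-1` [set l]) = (column_prob X l)%:E].

(* If column_prob X l = 0, then l is drawn with probability 0, and column l of X
   is zero; as x / 0 = 0, the corresponding column of the result is zero. *)
Definition subsample (R : realType) (m n s : nat) (X : 'M[R]_(m, n))
    (k : 'I_s -> 'I_n) : 'M[R]_(m, s) :=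
  \matrix_(i < m, t < s) (X i (k t) / Num.sqrt (s%:R * column_prob X (k t))).

(* Main.v *)
Require Import Defs.
From HB Require Import structures.
From mathcomp Require Import all_boot all_order all_algebra.
From mathcomp Require Import all_classical all_reals all_analysis.
From mathcomp Require Import ring lra measurable_realfun.
Import Order.TTheory GRing.Theory Num.Theory.
Import numFieldNormedType.Exports.

(** The Gram matrix [S *m S^T] is the empirical mean of [s] independent copies of a
    random matrix with mean [X *m X^T], namely the outer square of a random column
    divided by its probability.  Because columns are drawn with probability
    proportional to their squared length, this random matrix has Frobenius norm at
    most [B = frobenius_norm X ^+ 2] ([enorm_scaled_outer], [mean_scaled_outer]).

    Everything then rests on the Frobenius distance [D] between the two Gram
    matrices.  Its mean is at most [B / sqrt s], by additivity of variances
    ([mean_deviation]).  Changing one draw changes [D] by at most [2 * B / s], so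
    the bounded-difference inequality ([bounded_diff_tail], proved by Azuma's
    martingale argument in [mean_expR_bounded_diff]) shows that [D] exceeds
    [eta * B / sqrt s] with probability at most [beta] ([deviation_tail]).

    Finally [D] bounds the difference of the squared spectral norms
    ([dist_sqr_spectral_norm]), and dividing by the sum of the norms shows that the
    error is at most [D / spectral_norm X] ([dist_spectral_norm]).  The value of [s]
    is the one for which [eta * B / sqrt s] is [eps * spectral_norm X].

    The law of the sampled indices is a finite product measure, so the probabilistic
    estimates are statements about finite sums ([mean]); [expectation_sample]
    carries them over to the probability space. *)

Set Implicit Arguments.
Unset Strict Implicit.
Unset Printing Implicit Defensive.

Local Open Scope classical_set_scope.
Local Open Scope ring_scope.

(** * Two inequalities for the exponential *)

(** Convexity of [expR]: the tangent at the intermediate point lies below both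
    endpoint values, and averaging the two tangent inequalities gives the chord. *)
Lemma expR_chord (R : realType) (u a b : R) :
  0 <= u <= 1 -> expR (u * a + (1 - u) * b) <= u * expR a + (1 - u) * expR b.
Proof.
move=> /andP[u0 u1].
set v := u * a + (1 - u) * b.
have tangent (w : R) : expR v * (1 + (w - v)) <= expR w.
  have := expR_ge1Dx (w - v).
  by rewrite -(ler_pM2l (expR_gt0 v)) -expRD subrKC.
have -> : expR v = u * (expR v * (1 + (a - v))) + (1 - u) * (expR v * (1 + (b - v))).
  by rewrite /v; ring.
by rewrite lerD// ler_wpM2l ?tangent// subr_ge0.
Qed.

(** [expR (- (x ^+ 2 / 2)) * cosh x] equals 1 at 0 and is nonincreasing on the
    nonnegative half-line: its derivative has the sign of [sinh x - x * cosh x],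
    which is nonpositive because [x * cosh x - sinh x] vanishes at 0 and has
    derivative [x * sinh x]. *)
Lemma cosh_le_expR (R : realType) (x : R) :
  (expR x + expR (- x)) / 2 <= expR (x ^+ 2 / 2).
Proof.
wlog x0 : x / 0 <= x.
  move=> H; have [/H//|/ltW xle0] := leP 0 x.
  by have := H (- x); rewrite opprK sqrrN addrC; apply; rewrite oppr_ge0.
(* Twice [y * cosh y - sinh y], and twice the function shown to decrease. *)
pose h (y : R) : R := y * (expR y + expR (- y)) - (expR y - expR (- y)).
pose k (y : R) : R := (expR y + expR (- y)) * expR (- (y ^+ 2 / 2)).
have dh (y : R) : is_derive y 1 h (y * (expR y - expR (- y))).
  by rewrite /h; apply: is_derive_eq; rewrite /GRing.scale /=; ring.
have dk (y : R) : is_derive y 1 k (- h y * expR (- (y ^+ 2 / 2))).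
  by rewrite /k /h; apply: is_derive_eq; rewrite /GRing.scale /=; field.
have h_ge0 (y : R) : 0 <= y -> 0 <= h y.
  move=> y0; have -> : 0 = h 0 by rewrite /h oppr0 subrr mul0r subrr.
  apply: (@ger0_derive1_ndecry R h 0) => // [z|].
  - rewrite in_itv /= andbT => z0; rewrite derive1E (@derive_val _ _ _ _ _ _ _ (dh z)).
    by rewrite mulr_ge0 ?(ltW z0)// subr_ge0 ler_expR; lra.
  - by apply: continuous_subspaceT => z; apply/differentiable_continuous/derivable1_diffP.
have k_le : k x <= k 0.
  apply: (@ler0_derive1_nincry R k 0) => // [z|].
  - rewrite in_itv /= andbT => z0; rewrite derive1E (@derive_val _ _ _ _ _ _ _ (dk z)).
    by rewrite mulNr oppr_le0 mulr_ge0 ?expR_ge0// h_ge0// ltW.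
  - by apply: continuous_subspaceT => z; apply/differentiable_continuous/derivable1_diffP.
move: k_le; rewrite /k oppr0 expr0n mul0r oppr0 expR0 mulr1.
rewrite (expRN (x ^+ 2 / 2)) ler_pdivrMr ?expR_gt0//.
by move=> ?; rewrite ler_pdivrMr// mulrC.
Qed.

(** * Expectation over finitely many independent draws *)

Definition is_prob (R : realType) (L : finType) (q : L -> R) : Prop :=
  (forall l, 0 <= q l) /\ \sum_l q l = 1.

(** Expectation of [g] over [s] independent draws from [q].  The observable [g]
    takes a list rather than an [s]-tuple, so that fixing the first draw,
    [fun k => g (l :: k)], is again an observable of the same type; this is what
    makes induction on [s] possible. *)
Definition mean (R : realType) (L : finType) (q : L -> R) (s : nat)
    (g : seq L -> R) : R :=
  \sum_(k : s.-tuple L) (\prod_(l <- k) q l) * g k.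

Lemma mean0 (R : realType) (L : finType) (q : L -> R) (g : seq L -> R) :
  mean q 0 g = g [::].
Proof.
rewrite /mean (bigD1 [tuple])//= big_nil mul1r big1 ?addr0// => k /eqP[].
exact: tuple0.
Qed.

Lemma meanS (R : realType) (L : finType) (q : L -> R) (s : nat) (g : seq L -> R) :
  mean q s.+1 g = \sum_l q l * mean q s (fun k => g (l :: k)).
Proof.
rewrite /mean.
under [RHS]eq_bigr do rewrite big_distrr/=.
rewrite pair_big/=.
rewrite (reindex (fun p : L * s.-tuple L => [tuple of p.1 :: p.2]))/=; last first.
  exists (fun k => (thead k, behead_tuple k)) => [[l k] _|k _] /=.
    by congr pair; apply: val_inj.
  by rewrite [RHS]tuple_eta; apply: val_inj.
by apply: eq_bigr => -[l k] _ /=; rewrite big_cons mulrA.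
Qed.

Lemma meanD (R : realType) (L : finType) (q : L -> R) (s : nat) (f g : seq L -> R) :
  mean q s (fun k => f k + g k) = mean q s f + mean q s g.
Proof. by rewrite /mean -big_split/=; apply: eq_bigr => k _; rewrite mulrDr. Qed.

Lemma meanZ (R : realType) (L : finType) (q : L -> R) (s : nat) (a : R)
    (g : seq L -> R) :
  mean q s (fun k => a * g k) = a * mean q s g.
Proof. by rewrite /mean big_distrr/=; apply: eq_bigr => k _; rewrite mulrCA. Qed.

Lemma mean_sum (R : realType) (L K : finType) (q : L -> R) (s : nat)
    (g : K -> seq L -> R) :
  mean q s (fun k => \sum_x g x k) = \sum_x mean q s (g x).
Proof.
by rewrite /mean exchange_big/=; apply: eq_bigr => k _; rewrite big_distrr.
Qed.

Lemma mean_cst (R : realType) (L : finType) (q : L -> R) (s : nat) (a : R) :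
  is_prob q -> mean q s (fun=> a) = a.
Proof.
move=> [_ q1]; elim: s => [|s IH]; first by rewrite mean0.
by rewrite meanS; under eq_bigr do rewrite IH; rewrite -big_distrl/= q1 mul1r.
Qed.

Lemma eq_mean (R : realType) (L : finType) (q : L -> R) (s : nat)
    (f g : seq L -> R) :
  (forall k, size k = s -> f k = g k) -> mean q s f = mean q s g.
Proof. by move=> fg; apply: eq_bigr => k _; rewrite fg ?size_tuple. Qed.

Lemma le_mean (R : realType) (L : finType) (q : L -> R) (s : nat)
    (f g : seq L -> R) :
  is_prob q -> (forall k, size k = s -> f k <= g k) -> mean q s f <= mean q s g.
Proof.
move=> [q0 _] fg; apply: ler_sum => k _.
by rewrite ler_wpM2l ?fg ?size_tuple//; apply: prodr_ge0.
Qed.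

(** Jensen's inequality for the square, from the nonnegativity of the variance. *)
Lemma le_mean_sqrt (R : realType) (L : finType) (q : L -> R) (s : nat)
    (g : seq L -> R) :
  is_prob q -> mean q s g <= Num.sqrt (mean q s (fun k => g k ^+ 2)).
Proof.
move=> pq; set e := mean q s g.
rewrite (le_trans (ler_norm _))// -sqrtr_sqr ler_wsqrtr//.
have : 0 <= mean q s (fun k => (g k - e) ^+ 2).
  by rewrite -[leLHS](mean_cst s 0 pq) le_mean// => k _; rewrite sqr_ge0.
have -> : mean q s (fun k => (g k - e) ^+ 2) =
    mean q s (fun k => g k ^+ 2 + (- (2 * e) * g k + e ^+ 2)).
  by congr mean; apply/funext => k; ring.
by rewrite !meanD meanZ mean_cst// -/e; lra.
Qed.

(** Additivity of the variance: in the induction, the cross term between the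
    first draw and the others is killed by the centering of [y]. *)
Lemma mean_sqr_sum (R : realType) (L : finType) (q : L -> R) (s : nat) (y : L -> R) :
  is_prob q -> \sum_l q l * y l = 0 ->
  mean q s (fun k => (\sum_(l <- k) y l) ^+ 2) = s%:R * \sum_l q l * y l ^+ 2.
Proof.
move=> pq y0; elim: s => [|s IH]; first by rewrite mean0 big_nil expr0n mul0r.
rewrite meanS.
pose e := mean q s (fun k => \sum_(i <- k) y i).
have step l : mean q s (fun k => (\sum_(i <- l :: k) y i) ^+ 2) =
    y l ^+ 2 + (2 * e * y l + s%:R * \sum_i q i * y i ^+ 2).
  rewrite -IH -[y l ^+ 2](mean_cst s _ pq) mulrAC -meanZ -!meanD.
  by congr mean; apply/funext => k; rewrite big_cons; ring.
under eq_bigr do rewrite step !mulrDr (mulrCA _ (2 * e)).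
rewrite !big_split/= -!big_distrr/= y0 mulr0 add0r -big_distrl/= pq.2 mul1r.
by rewrite -[s.+1]add1n natrD mulrDl mul1r.
Qed.

(** Hoeffding's lemma for a function of oscillation [c], with the constant 1/2
    instead of the optimal 1/8.  The centered variable lies in [[-c, c]], where the
    exponential is below its chord; the chord has mean [cosh (lam * c)] since its
    linear part is centered. *)
Lemma hoeffding (R : realType) (L : finType) (q : L -> R) (h : L -> R) (lam c : R) :
  is_prob q -> (forall l l', `|h l - h l'| <= c) ->
  \sum_l q l * expR (lam * (h l - \sum_l' q l' * h l')) <=
  expR ((lam * c) ^+ 2 / 2).
Proof.
move=> [q0 q1] hc; set e := \sum_l' q l' * h l'.
have mid l : `|h l - e| <= c.
  have -> : h l - e = \sum_l' q l' * (h l - h l').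
    under eq_bigr do rewrite mulrBr.
    by rewrite sumrB -big_distrl/= q1 mul1r.
  rewrite (le_trans (ler_norm_sum _ _ _))// -[leRHS]mul1r -q1 big_distrl/=.
  by apply: ler_sum => l' _; rewrite normrM ger0_norm// ler_wpM2l.
have center : \sum_l q l * (h l - e) = 0.
  under eq_bigr do rewrite mulrBr.
  by rewrite sumrB -big_distrl/= q1 mul1r subrr.
(* Barycentric coordinate of [h l - e] in the interval from [-c] to [c];
   for [c = 0] the convention [x / 0 = 0] gives the midpoint. *)
pose u l := (1 + (h l - e) / c) / 2.
have chord l : expR (lam * (h l - e)) <=
    u l * expR (lam * c) + (1 - u l) * expR (- (lam * c)).
  have [c0|c0] := eqVneq c 0.
    move: (mid l); rewrite /u c0 normr_le0 => /eqP ->.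
    by rewrite !mulr0 mul0r oppr0 expR0; lra.
  have c_gt0 : 0 < c by rewrite lt_def c0 (le_trans _ (mid l)).
  have -> : lam * (h l - e) = u l * (lam * c) + (1 - u l) * - (lam * c).
    by rewrite /u; field.
  have : -1 <= (h l - e) / c <= 1.
    by rewrite -ler_norml normrM normfV (gtr0_norm c_gt0) ler_pdivrMr// mul1r.
  by move=> ?; apply: expR_chord; rewrite /u; lra.
apply: le_trans (cosh_le_expR _).
apply: (@le_trans _ _ (\sum_l q l *
    (u l * expR (lam * c) + (1 - u l) * expR (- (lam * c))))).
  by apply: ler_sum => l _; rewrite ler_wpM2l.
rewrite le_eqVlt; apply/orP; left; apply/eqP.
have -> : \sum_l q l * (u l * expR (lam * c) + (1 - u l) * expR (- (lam * c))) =
  \sum_l (q l * ((expR (lam * c) + expR (- (lam * c))) / 2) +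
    q l * (h l - e) * ((expR (lam * c) - expR (- (lam * c))) / (2 * c))).
  by apply: eq_bigr => l _; rewrite /u invfM; set ci := c^-1; field.
by rewrite big_split/= -!big_distrl/= q1 center mul0r addr0 mul1r.
Qed.

(** * Concentration under bounded differences *)

(** Azuma's argument.  Conditionally on the first draw [l] the induction hypothesis
    controls the fluctuation around the conditional mean [h l]; as [h] has
    oscillation at most [c], Hoeffding's lemma controls that of [h l] around the
    mean. *)
Lemma mean_expR_bounded_diff (R : realType) (L : finType) (q : L -> R) (s : nat)
    (g : seq L -> R) (lam c : R) :
  is_prob q ->
  (forall u l l' v, `|g (u ++ l :: v) - g (u ++ l' :: v)| <= c) ->
  mean q s (fun k => expR (lam * (g k - mean q s g))) <=
  expR (s%:R * ((lam * c) ^+ 2 / 2)).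
Proof.
move=> pq; elim: s g => [|s IH] g gc.
  by rewrite !mean0 subrr mulr0 mul0r.
pose h l := mean q s (fun k => g (l :: k)).
have hc l l' : `|h l - h l'| <= c.
  have le_h a b : h a - h b <= c.
    rewrite lerBlDr -[c](mean_cst s c pq) -meanD; apply: le_mean => // k _.
    by rewrite -lerBlDr (le_trans (ler_norm _))// (gc [::]).
  by rewrite ler_norml le_h andbT -opprB lerN2 le_h.
rewrite [leLHS]meanS [mean q s.+1 g]meanS -/h.
have step l : mean q s (fun k => expR (lam * (g (l :: k) - \sum_i q i * h i))) <=
    expR (lam * (h l - \sum_i q i * h i)) * expR (s%:R * ((lam * c) ^+ 2 / 2)).
  rewrite (@eq_mean _ _ _ _ _ (fun k => expR (lam * (h l - \sum_i q i * h i)) *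
    expR (lam * (g (l :: k) - h l)))); last first.
    by move=> k _; rewrite -expRD; congr expR; ring.
  rewrite meanZ ler_pM2l ?expR_gt0//.
  by apply: (IH (fun k => g (l :: k))) => u a b v; apply: (gc (l :: u)).
apply: (@le_trans _ _ (\sum_l q l * (expR (lam * (h l - \sum_i q i * h i)) *
    expR (s%:R * ((lam * c) ^+ 2 / 2))))).
  by apply: ler_sum => l _; rewrite ler_wpM2l ?pq.1 ?step.
under eq_bigr do rewrite mulrA.
rewrite -big_distrl/= -[s.+1]add1n natrD mulrDl mul1r expRD ler_pM2r ?expR_gt0//.
exact: hoeffding.
Qed.

(** Chernoff's bound for the preceding exponential moments. *)
Lemma bounded_diff_tail (R : realType) (L : finType) (q : L -> R) (s : nat)
    (g : seq L -> R) (c t : R) :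
  is_prob q -> (0 < s)%N -> 0 < c -> 0 <= t ->
  (forall u l l' v, `|g (u ++ l :: v) - g (u ++ l' :: v)| <= c) ->
  mean q s (fun k => (mean q s g + t < g k)%R%:R) <=
  expR (- (t ^+ 2 / (2 * s%:R * c ^+ 2))).
Proof.
move=> pq s0 c0 t0 gc.
have s0R : 0 < s%:R :> R by rewrite ltr0n.
(* Minimizes the exponent [s * (lam * c)^2 / 2 - lam * t]. *)
pose lam := t / (s%:R * c ^+ 2).
have lam0 : 0 <= lam by rewrite divr_ge0// mulr_ge0// ?sqr_ge0// ltW.
apply: (@le_trans _ _ (mean q s (fun k =>
    expR (- (lam * t)) * expR (lam * (g k - mean q s g))))).
  apply: le_mean => // k _; rewrite -expRD.
  have [gt|_] := ltP; last exact: expR_ge0.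
  by rewrite -expR0 ler_expR addrC -mulrBr mulr_ge0// subr_ge0 lerBrDl ltW.
rewrite meanZ (le_trans (ler_wpM2l (expR_ge0 _) (mean_expR_bounded_diff _ _ pq gc)))//.
rewrite -expRD ler_expR le_eqVlt; apply/orP; left; apply/eqP.
by rewrite /lam; field; rewrite (gt_eqF c0) (gt_eqF s0R).
Qed.

(** * Euclidean norm of finite families *)

(** Both the Euclidean norm of a column and the Frobenius norm of a matrix are of
    this form, the latter with pairs of indices for [K]. *)
Definition enorm (R : realType) (K : finType) (a : K -> R) : R :=
  Num.sqrt (\sum_x a x ^+ 2).

Lemma enorm_ge0 (R : realType) (K : finType) (a : K -> R) : 0 <= enorm a.
Proof. exact: sqrtr_ge0. Qed.

Lemma sqr_enorm (R : realType) (K : finType) (a : K -> R) :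
  enorm a ^+ 2 = \sum_x a x ^+ 2.
Proof. by rewrite sqr_sqrtr// sumr_ge0// => x _; rewrite sqr_ge0. Qed.

Lemma enormZ (R : realType) (K : finType) (c : R) (a : K -> R) :
  enorm (fun x => c * a x) = `|c| * enorm a.
Proof.
rewrite /enorm; under eq_bigr do rewrite exprMn.
by rewrite -big_distrr/= sqrtrM ?sqr_ge0// sqrtr_sqr.
Qed.

Lemma cauchy_schwarz (R : realType) (K : finType) (a b : K -> R) :
  `|\sum_x a x * b x| <= enorm a * enorm b.
Proof.
rewrite -ler_sqr ?nnegrE ?mulr_ge0 ?enorm_ge0// real_normK ?num_real//.
rewrite exprMn; set p := \sum_x _; set B := enorm b ^+ 2.
have [b0|B0] := eqVneq B 0.
  suff -> : p = 0 by rewrite expr0n b0 mulr0.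
  move: b0; rewrite /B sqr_enorm => /eqP.
  rewrite psumr_eq0 => [/allP b0|x _]; last exact: sqr_ge0.
  apply: big1 => x _; have := b0 x (mem_index_enum x).
  by rewrite sqrf_eq0 => /eqP ->; rewrite mulr0.
have B_gt0 : 0 < B by rewrite lt_def B0 sqr_ge0.
(* Up to the factor [B ^+ 2], the squared residual of the projection of [a] on [b]. *)
have : 0 <= \sum_x (B * a x - p * b x) ^+ 2 by apply: sumr_ge0 => x _; exact: sqr_ge0.
have -> : \sum_x (B * a x - p * b x) ^+ 2 = B * (enorm a ^+ 2 * B - p ^+ 2).
  rewrite (eq_bigr (fun x => B ^+ 2 * a x ^+ 2 +
    (- (2 * B * p) * (a x * b x) + p ^+ 2 * b x ^+ 2))); last by move=> x _; ring.
  by rewrite !big_split/= -!big_distrr/= -/p -!sqr_enorm -/B; ring.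
by rewrite pmulr_rge0// subr_ge0.
Qed.

Lemma le_enormD (R : realType) (K : finType) (a b : K -> R) :
  enorm (fun x => a x + b x) <= enorm a + enorm b.
Proof.
rewrite -ler_sqr ?nnegrE ?addr_ge0 ?enorm_ge0// sqrrD !sqr_enorm.
under eq_bigr do rewrite sqrrD.
rewrite !big_split/= lerD2r lerD2l -mulr2n lerMn2r/=.
exact: le_trans (ler_norm _) (cauchy_schwarz a b).
Qed.

Lemma le_dist_enorm (R : realType) (K : finType) (a b : K -> R) :
  `|enorm a - enorm b| <= enorm (fun x => a x - b x).
Proof.
have H (u v : K -> R) : enorm u - enorm v <= enorm (fun x => u x - v x).
  rewrite lerBlDr (le_trans _ (le_enormD _ _))// le_eqVlt; apply/orP; left.
  by apply/eqP; congr enorm; apply/funext => x; rewrite subrK.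
rewrite ler_norml H andbT -opprB lerN2 (le_trans (H b a))// le_eqVlt.
apply/orP; left; apply/eqP; rewrite -[RHS]mul1r -(normrN1 R) -enormZ.
by congr enorm; apply/funext => x; ring.
Qed.

(** * Deviation of empirical means of bounded vectors *)

(** Distance from the empirical mean of the vectors [Z l], for [l] in a sample [k]
    of size [s], to their mean under [q]. *)
Definition deviation (R : realType) (L K : finType) (q : L -> R) (Z : L -> K -> R)
    (s : nat) (k : seq L) : R :=
  enorm (fun x => (\sum_(l <- k) Z l x) / s%:R - \sum_l q l * Z l x).

(** The variances of the [s] independent draws add up, so the mean squared
    deviation is at most [B ^+ 2 / s]. *)
Lemma mean_deviation (R : realType) (L K : finType) (q : L -> R) (Z : L -> K -> R)
    (s : nat) (B : R) :
  is_prob q -> (0 < s)%N -> 0 <= B -> (forall l, enorm (Z l) <= B) ->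
  mean q s (deviation q Z s) <= B / Num.sqrt s%:R.
Proof.
move=> pq s0 B0 ZB.
have s0R : s%:R != 0 :> R by rewrite pnatr_eq0 -lt0n.
apply: le_trans (le_mean_sqrt _ _ pq) _.
have -> : B / Num.sqrt s%:R = Num.sqrt (B ^+ 2 / s%:R).
  by rewrite sqrtrM ?sqr_ge0// sqrtr_sqr ger0_norm// sqrtrV ?ler0n.
apply: ler_wsqrtr.
pose mu x := \sum_l q l * Z l x.
pose y x l := Z l x - mu x.
rewrite (@eq_mean _ _ _ _ _ (fun k =>
    \sum_x s%:R ^- 2 * (\sum_(l <- k) y x l) ^+ 2)); last first.
  move=> k ks; rewrite sqr_enorm; apply: eq_bigr => x _.
  rewrite -exprVn -exprMn; congr (_ ^+ 2).
  rewrite /y sumrB big_const_seq count_predT ks iter_addr_0 -mulr_natr -/(mu x).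
  by field.
rewrite mean_sum.
have centered x : \sum_l q l * y x l = 0.
  under eq_bigr do rewrite mulrBr.
  by rewrite sumrB -big_distrl/= pq.2 mul1r subrr.
have var x : \sum_l q l * y x l ^+ 2 <= \sum_l q l * Z l x ^+ 2.
  rewrite (eq_bigr (fun l => q l * Z l x ^+ 2 +
    (- (2 * mu x) * (q l * Z l x) + mu x ^+ 2 * q l))); last first.
    by move=> l _; rewrite /y; ring.
  rewrite !big_split/= -!big_distrr/= pq.2 -/(mu x).
  by have := sqr_ge0 (mu x); rewrite expr2; lra.
apply: (@le_trans _ _ (\sum_x s%:R^-1 * \sum_l q l * Z l x ^+ 2)).
  apply: ler_sum => x _; rewrite meanZ mean_sqr_sum//.
  rewrite mulrA (_ : _ * s%:R = s%:R^-1); last by field.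
  by rewrite ler_wpM2l ?invr_ge0// ler0n.
rewrite -big_distrr/= mulrC ler_wpM2r ?invr_ge0 ?ler0n//.
rewrite exchange_big/= -[leRHS]mul1r -pq.2 big_distrl/=.
apply: ler_sum => l _; rewrite -big_distrr/= ler_wpM2l ?pq.1// -sqr_enorm.
by rewrite ler_sqr ?nnegrE ?enorm_ge0.
Qed.

(** Replacing one draw moves the empirical mean by at most [2 * B / s].  The
    bounded-difference tail beyond [t = sqrt (8 * ln (1 / beta)) * B / sqrt s] is
    then [exp (- ln (1 / beta)) = beta]: this is where the constant 8 comes from.
    The summand 1 in front of the root accounts for the mean of the deviation. *)
Lemma deviation_tail (R : realType) (L K : finType) (q : L -> R) (Z : L -> K -> R)
    (s : nat) (B beta : R) :
  is_prob q -> (0 < s)%N -> 0 < B -> (forall l, enorm (Z l) <= B) ->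
  0 < beta <= 1 ->
  mean q s (fun k => ((1 + Num.sqrt (8 * ln (1 / beta))) * (B / Num.sqrt s%:R) <
    deviation q Z s k)%R%:R) <= beta.
Proof.
move=> pq s0 B0 ZB /andP[beta0 beta1].
have s0R : 0 < s%:R :> R by rewrite ltr0n.
set r := B / Num.sqrt s%:R.
have r0 : 0 <= r by rewrite divr_ge0 ?sqrtr_ge0// ltW.
have ln0 : 0 <= ln (1 / beta) by rewrite ln_ge0// ler_pdivlMr// mul1r.
set t := Num.sqrt (8 * ln (1 / beta)) * r.
have t0 : 0 <= t by rewrite mulr_ge0 ?sqrtr_ge0.
have bdiff u l l' v : `|deviation q Z s (u ++ l :: v) - deviation q Z s (u ++ l' :: v)|
    <= 2 * B / s%:R.
  apply: le_trans (le_dist_enorm _ _) _.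
  rewrite (_ : (fun x => _) = (fun x => s%:R^-1 * (Z l x + (-1) * Z l' x))); last first.
    by apply/funext => x; rewrite !big_cat/= !big_cons; ring.
  rewrite enormZ ger0_norm ?invr_ge0 ?ler0n// mulrC ler_wpM2r ?invr_ge0 ?ler0n//.
  rewrite (le_trans (le_enormD _ _))// enormZ normrN1 mul1r.
  by have := ZB l; have := ZB l'; lra.
apply: (@le_trans _ _ (expR (- (t ^+ 2 / (2 * s%:R * (2 * B / s%:R) ^+ 2))))); last first.
  rewrite (_ : _ / _ = ln (1 / beta)).
    by rewrite div1r lnV ?posrE// opprK lnK.
  rewrite /t /r !exprMn !exprVn !sqr_sqrtr ?mulr_ge0 ?ler0n//.
  by field; rewrite (gt_eqF s0R) (gt_eqF B0).
apply: le_trans (bounded_diff_tail pq s0 _ t0 bdiff); last first.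
  by rewrite divr_gt0 ?mulr_gt0.
apply: le_mean => // k _; rewrite ler_nat.
have [dev_gt|//] := ltP _ (deviation q Z s k).
rewrite (le_lt_trans _ dev_gt)// mulrDl mul1r lerD2r.
exact: mean_deviation (ltW B0) ZB.
Qed.

(** The sample size is chosen so that the tail radius of the deviation, divided by
    [sigma], is exactly [eps]; the bound on the mean is smaller by a factor
    [1 + sqrt (8 * ln (1 / beta))]. *)
Lemma mean_dominated_error (R : realType) (L K : finType) (q : L -> R)
    (Z : L -> K -> R) (s : nat) (B sigma beta eps : R) (e : seq L -> R) :
  is_prob q -> (0 < s)%N -> 0 < B -> (forall l, enorm (Z l) <= B) ->
  0 < sigma -> 0 < beta <= 1 -> 0 < eps ->
  s%:R = ((1 + Num.sqrt (8 * ln (1 / beta))) * B / (eps * sigma)) ^+ 2 ->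
  (forall k, size k = s -> e k <= deviation q Z s k / sigma) ->
  mean q s e <= eps /\ 1 - beta <= mean q s (fun k => (e k <= eps)%R%:R).
Proof.
move=> pq s0 B0 ZB sigma0 beta01 eps0; set eta := 1 + _ => sE e_le.
have eta1 : 1 <= eta by rewrite lerDl sqrtr_ge0.
have eta0 : 0 < eta by rewrite (lt_le_trans _ eta1).
have radius : eta * (B / Num.sqrt s%:R) = eps * sigma.
  rewrite sE sqrtr_sqr gtr0_norm; last by rewrite divr_gt0 ?mulr_gt0.
  by field; rewrite !gt_eqF.
split.
  apply: (@le_trans _ _ (mean q s (fun k => sigma^-1 * deviation q Z s k))).
    by apply: le_mean => // k ks; rewrite mulrC e_le.
  rewrite meanZ mulrC ler_pdivrMr// -radius.
  apply: le_trans (mean_deviation pq s0 (ltW B0) ZB) _.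
  by rewrite ler_peMl// divr_ge0 ?sqrtr_ge0// ltW.
rewrite lerBlDr -[leLHS](mean_cst s 1 pq).
apply: le_trans (lerD (lexx _) (deviation_tail pq s0 B0 ZB beta01)).
rewrite -meanD; apply: le_mean => // k ks; rewrite -/eta radius.
case: ltP => [_|dev_le]; first by rewrite lerDr ler0n.
suff -> : e k <= eps by rewrite addr0.
by rewrite (le_trans (e_le k ks))// ler_pdivrMr.
Qed.

(** * Spectral norm *)

Lemma l2normZ (R : realType) (n : nat) (c : R) (v : 'cV[R]_n) :
  l2norm (c *: v) = `|c| * l2norm v.
Proof.
rewrite /l2norm -(enormZ c (fun i => v i 0)).
by congr Num.sqrt; apply: eq_bigr => i _; rewrite mxE.
Qed.

Lemma sqr_l2norm (R : realType) (n : nat) (v : 'cV[R]_n) :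
  l2norm v ^+ 2 = (v^T *m v) 0 0.
Proof.
rewrite (sqr_enorm (fun i => v i 0)) mxE.
by apply: eq_bigr => i _; rewrite mxE expr2.
Qed.

Lemma mulmx_tr_le_l2norm (R : realType) (n : nat) (u v : 'cV[R]_n) :
  `|(u^T *m v) 0 0| <= l2norm u * l2norm v.
Proof.
rewrite mxE; under eq_bigr do rewrite mxE.
exact: (cauchy_schwarz (fun i => u i 0) (fun i => v i 0)).
Qed.

Lemma frobenius_normE (R : realType) (m n : nat) (A : 'M[R]_(m, n)) :
  frobenius_norm A = enorm (fun p : 'I_m * 'I_n => A p.1 p.2).
Proof. by rewrite /frobenius_norm pair_big. Qed.

Lemma l2norm_mulmx_frobenius (R : realType) (m n : nat) (A : 'M[R]_(m, n))
    (v : 'cV[R]_n) :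
  l2norm (A *m v) <= frobenius_norm A * l2norm v.
Proof.
rewrite -ler_sqr ?nnegrE ?mulr_ge0 ?sqrtr_ge0// exprMn.
rewrite [leLHS](sqr_enorm (fun i => (A *m v) i 0)) [_ A ^+ 2]sqr_sqrtr; last first.
  by apply: sumr_ge0 => i _; apply: sumr_ge0 => k _; exact: sqr_ge0.
rewrite big_distrl/=; apply: ler_sum => i _.
rewrite -(sqr_enorm (A i)) -exprMn -real_normK ?num_real// ler_sqr ?nnegrE//; last first.
  by rewrite mulr_ge0 ?enorm_ge0// sqrtr_ge0.
by rewrite mxE; exact: (cauchy_schwarz (A i) (fun k => v k 0)).
Qed.

Lemma has_sup_spectral (R : realType) (m n : nat) (A : 'M[R]_(m, n)) :
  has_sup [set l2norm (A *m v) | v in [set v : 'cV[R]_n | l2norm v <= 1]].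
Proof.
split.
  exists (l2norm (A *m 0)), 0 => //=.
  by rewrite -(scale0r 0) l2normZ normr0 mul0r.
exists (frobenius_norm A) => _ [v /= v1 <-].
by rewrite (le_trans (l2norm_mulmx_frobenius A v))// ler_piMr// sqrtr_ge0.
Qed.

Lemma spectral_norm_ge0 (R : realType) (m n : nat) (A : 'M[R]_(m, n)) :
  0 <= spectral_norm A.
Proof.
apply: (@le_trans _ _ (l2norm (A *m 0))); first exact: sqrtr_ge0.
apply: (ub_le_sup (has_sup_spectral A).2); exists 0 => //=.
by rewrite -(scale0r 0) l2normZ normr0 mul0r.
Qed.

Lemma l2norm_eq0 (R : realType) (n : nat) (v : 'cV[R]_n) : l2norm v = 0 -> v = 0.
Proof.
move=> v0; have /eqP := sqr_enorm (fun i => v i 0).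
rewrite [enorm _]v0 expr0n eq_sym psumr_eq0 => [/allP H|i _]; last exact: sqr_ge0.
apply/matrixP => i k; rewrite ord1 mxE.
by have := H i (mem_index_enum i); rewrite sqrf_eq0 => /eqP.
Qed.

Lemma l2norm_mulmx (R : realType) (m n : nat) (A : 'M[R]_(m, n)) (v : 'cV[R]_n) :
  l2norm (A *m v) <= spectral_norm A * l2norm v.
Proof.
have [/l2norm_eq0 ->|v0] := eqVneq (l2norm v) 0.
  rewrite mulmx0 -(scale0r 0) l2normZ normr0 mul0r.
  by rewrite mulr_ge0 ?spectral_norm_ge0// sqrtr_ge0.
have v_gt0 : 0 < l2norm v by rewrite lt_def v0 sqrtr_ge0.
rewrite -ler_pdivrMr// mulrC -[_^-1]ger0_norm ?invr_ge0 ?sqrtr_ge0//.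
rewrite -l2normZ scalemxAr.
apply: (ub_le_sup (has_sup_spectral A).2); eexists; last reflexivity.
by rewrite /= l2normZ normfV gtr0_norm// mulVf.
Qed.

Lemma spectral_norm_le (R : realType) (m n : nat) (A : 'M[R]_(m, n)) (c : R) :
  0 <= c -> (forall v, l2norm (A *m v) <= c * l2norm v) -> spectral_norm A <= c.
Proof.
move=> c0 Ac; apply: ge_sup; first exact: (has_sup_spectral A).1.
by move=> _ [v /= v1 <-]; rewrite (le_trans (Ac v))// ler_piMr.
Qed.

Lemma sqr_l2norm_tr (R : realType) (m n : nat) (A : 'M[R]_(m, n)) (u : 'cV[R]_m) :
  l2norm (A^T *m u) ^+ 2 = (u^T *m (A *m A^T *m u)) 0 0.
Proof. by rewrite sqr_l2norm trmx_mul trmxK !mulmxA. Qed.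

(** [|A^T u|^2 = <u, A (A^T u)>] is at most [|u| * |A| * |A^T u|]. *)
Lemma spectral_norm_tr (R : realType) (m n : nat) (A : 'M[R]_(m, n)) :
  spectral_norm A^T = spectral_norm A.
Proof.
have le_tr p r (C : 'M[R]_(p, r)) : spectral_norm C^T <= spectral_norm C.
  apply: spectral_norm_le => [|u]; first exact: spectral_norm_ge0.
  have [->|w0] := eqVneq (l2norm (C^T *m u)) 0.
    by rewrite mulr_ge0 ?spectral_norm_ge0// sqrtr_ge0.
  have w_gt0 : 0 < l2norm (C^T *m u) by rewrite lt_def w0 sqrtr_ge0.
  rewrite -(ler_pM2r w_gt0) -expr2 sqr_l2norm_tr -mulmxA.
  rewrite (le_trans (ler_norm _))// (le_trans (mulmx_tr_le_l2norm _ _))//.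
  by rewrite mulrAC mulrC ler_wpM2r ?sqrtr_ge0// l2norm_mulmx.
by apply/eqP; rewrite eq_le le_tr -{1}[A]trmxK le_tr.
Qed.

(** After transposing, the squared norms are suprema of the quadratic forms of
    [A *m A^T] and [B *m B^T], which have the same size even when [A] and [B] have
    different numbers of columns. *)
Lemma dist_sqr_spectral_norm (R : realType) (m s n : nat) (A : 'M[R]_(m, s))
    (B : 'M[R]_(m, n)) :
  `|spectral_norm A ^+ 2 - spectral_norm B ^+ 2| <=
  frobenius_norm (A *m A^T - B *m B^T).
Proof.
have half p r (C : 'M[R]_(m, p)) (E : 'M[R]_(m, r)) :
    spectral_norm C ^+ 2 <=
    spectral_norm E ^+ 2 + frobenius_norm (C *m C^T - E *m E^T).
  set D := C *m C^T - _; set c := _ + _.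
  have c0 : 0 <= c by rewrite addr_ge0 ?sqr_ge0 ?sqrtr_ge0.
  rewrite -(sqr_sqrtr c0) ler_sqr ?nnegrE ?spectral_norm_ge0 ?sqrtr_ge0//.
  rewrite -spectral_norm_tr; apply: spectral_norm_le => [|u]; first exact: sqrtr_ge0.
  rewrite -ler_sqr ?nnegrE ?mulr_ge0 ?sqrtr_ge0// exprMn (sqr_sqrtr c0).
  have -> : l2norm (C^T *m u) ^+ 2 = l2norm (E^T *m u) ^+ 2 + (u^T *m (D *m u)) 0 0.
    by rewrite !sqr_l2norm_tr /D mulmxBl mulmxBr !mxE; ring.
  rewrite /c mulrDl lerD//.
    rewrite -exprMn ler_sqr ?nnegrE ?mulr_ge0 ?spectral_norm_ge0 ?sqrtr_ge0//.
    by rewrite -(spectral_norm_tr E) l2norm_mulmx.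
  rewrite (le_trans (ler_norm _))// (le_trans (mulmx_tr_le_l2norm _ _))//.
  by rewrite expr2 mulrA mulrC ler_wpM2r ?sqrtr_ge0// l2norm_mulmx_frobenius.
have frobC : frobenius_norm (A *m A^T - B *m B^T) = frobenius_norm (B *m B^T - A *m A^T).
  rewrite /frobenius_norm; congr Num.sqrt.
  by apply: eq_bigr => i _; apply: eq_bigr => k _; rewrite -sqrrN !mxE opprB.
by rewrite ler_norml lerNl opprB !lerBlDl half frobC half.
Qed.

Lemma spectral_norm_gt0 (R : realType) (m n : nat) (A : 'M[R]_(m, n)) :
  A != 0 -> 0 < spectral_norm A.
Proof.
move=> A0; rewrite lt_def spectral_norm_ge0 andbT.
apply: contra_neq A0 => A0; apply/matrixP => i k; rewrite mxE.
have /l2norm_eq0/matrixP/(_ i 0) : l2norm (A *m delta_mx k (0 : 'I_1)) = 0.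
  apply/eqP; rewrite eq_le sqrtr_ge0 andbT.
  by rewrite (le_trans (l2norm_mulmx A _))// A0 mul0r.
by rewrite -colE !mxE.
Qed.

(** Difference of squares: [a ^+ 2 - b ^+ 2] is [(a - b) * (a + b)] with
    [a + b >= b]. *)
Lemma dist_spectral_norm (R : realType) (m s n : nat) (A : 'M[R]_(m, s))
    (B : 'M[R]_(m, n)) :
  B != 0 ->
  `|spectral_norm A - spectral_norm B| <=
  frobenius_norm (A *m A^T - B *m B^T) / spectral_norm B.
Proof.
move=> /spectral_norm_gt0 B0.
rewrite ler_pdivlMr// (le_trans _ (dist_sqr_spectral_norm A B))//.
rewrite subr_sqr normrM ler_wpM2l// ger0_norm ?addr_ge0 ?spectral_norm_ge0//.
by rewrite lerDr spectral_norm_ge0.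
Qed.

(** * Law of the sample *)

Definition sample (T : Type) (s n : nat) (j : 'I_s -> T -> 'I_n) (w : T) :
  s.-tuple 'I_n := [tuple j t w | t < s].

(** Fibers of the sample are intersections of events about single draws, which is
    the form to which independence applies. *)
Lemma preimage_sample (T : Type) (s n : nat) (j : 'I_s -> T -> 'I_n)
    (k : s.-tuple 'I_n) :
  sample j @^-1` [set k] =
  \bigcap_(t in [set` [set: 'I_s]%SET]) (j t @^-1` [set tnth k t]).
Proof.
apply/seteqP; split=> w /=; first by move=> <- t _; rewrite /= tnth_mktuple.
by move=> kw; apply/eq_from_tnth => t; rewrite tnth_mktuple kw//= inE.
Qed.

Lemma measurable_preimage_sample d (T : measurableType d) (s n : nat)
    (j : 'I_s -> T -> 'I_n) (A : set (s.-tuple 'I_n)) :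
  (forall t, measurable_index (j t)) -> measurable (sample j @^-1` A).
Proof.
move=> mj; rewrite (_ : _ @^-1` A = \bigcup_(k in A) (sample j @^-1` [set k])).
  apply: fin_bigcup_measurable => [|k _]; first exact: finite_finset.
  rewrite preimage_sample; apply: fin_bigcap_measurable; first exact: finite_finset.
  by move=> t _; exact: mj.
apply/seteqP; split=> [w Aw|w [k Ak kw]]; first by exists (sample j w).
by rewrite /preimage/= (kw : sample j w = k).
Qed.

(** Transfer of integrals over the probability space to finite sums: the integrand
    is a combination of indicators of the fibers of the sample, and independence
    gives their probabilities. *)
Lemma expectation_sample d (T : measurableType d) (R : realType)
    (P : probability T R) (s n : nat) (q : 'I_n -> R) (j : 'I_s -> T -> 'I_n)
    (g : seq 'I_n -> R) :
  (forall t, measurable_index (j t)) -> mutually_independent P j ->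
  (forall t l, P (j t @^-1` [set l]) = (q l)%:E) -> (forall k, 0 <= g k) ->
  ('E_P[fun w => g (sample j w)] = (mean q s g)%:E)%E.
Proof.
move=> mj ij qj g0; rewrite unlock.
pose atom k := sample j @^-1` [set k].
have matom k : measurable (atom k) by exact: measurable_preimage_sample.
have Patom k : P (atom k) = (\prod_(l <- k) q l)%:E.
  rewrite /atom preimage_sample ij big_tuple -prodEFin.
  by apply: eq_big => [t|t _]; rewrite ?inE ?qj.
transitivity (\int[P]_w (\sum_(k : s.-tuple 'I_n) (g k * \1_(atom k) w)%:E)%E)%E.
  apply: eq_integral => w _; rewrite sumEFin (bigD1 (sample j w))//=.
  rewrite indicE mem_set// mulr1 big1 ?addr0// => k /eqP kw.
  by rewrite indicE memNset ?mulr0// => /esym.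
rewrite ge0_integral_sum//=; last 2 first.
- by move=> k; apply/measurable_EFinP; apply: measurable_funM.
- by move=> k w _; rewrite lee_fin mulr_ge0.
rewrite /mean -sumEFin; apply: eq_bigr => k _.
rewrite (integralZl_indic _ (fun=> atom k))// => [|]; last by rewrite ltNge g0.
by rewrite integral_indic//= setIT Patom -EFinM mulrC.
Qed.

(** * Column sampling *)

Lemma sqr_frobenius_norm (R : realType) (m n : nat) (X : 'M[R]_(m, n)) :
  frobenius_norm X ^+ 2 = \sum_l l2norm (col l X) ^+ 2.
Proof.
rewrite frobenius_normE sqr_enorm -(pair_big xpredT xpredT (fun i l => X i l ^+ 2))/=.
rewrite exchange_big/=; apply: eq_bigr => l _.
by rewrite [RHS](sqr_enorm (fun i => col l X i 0)); apply: eq_bigr => i _; rewrite mxE.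
Qed.

Lemma frobenius_norm_gt0 (R : realType) (m n : nat) (X : 'M[R]_(m, n)) :
  X != 0 -> 0 < frobenius_norm X.
Proof.
move=> /spectral_norm_gt0 X0; apply: (lt_le_trans X0).
by apply: spectral_norm_le; [exact: sqrtr_ge0|exact: l2norm_mulmx_frobenius].
Qed.

Lemma column_prob_is_prob (R : realType) (m n : nat) (X : 'M[R]_(m, n)) :
  X != 0 -> is_prob (column_prob X).
Proof.
move=> /frobenius_norm_gt0 F0; split=> [l|].
  by rewrite divr_ge0 ?sqr_ge0.
by rewrite -big_distrl/= -sqr_frobenius_norm divff// sqrf_eq0 gt_eqF.
Qed.

(** Entries of the outer square of column [l] divided by its probability, so that
    [S *m S^T] is the empirical mean of these matrices. *)
Definition scaled_outer (R : realType) (m n : nat) (X : 'M[R]_(m, n)) (l : 'I_n)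
    (p : 'I_m * 'I_m) : R :=
  X p.1 l * X p.2 l / column_prob X l.

(** Sampling proportionally to squared column norms is what makes these matrices,
    for all nonzero columns, have the same Frobenius norm: the outer square of
    column [l] has norm [l2norm (col l X) ^+ 2], which is also the probability of
    column [l] multiplied by [frobenius_norm X ^+ 2]. *)
Lemma enorm_scaled_outer (R : realType) (m n : nat) (X : 'M[R]_(m, n)) (l : 'I_n) :
  X != 0 -> enorm (scaled_outer X l) <= frobenius_norm X ^+ 2.
Proof.
move=> X0.
have -> : scaled_outer X l = fun p => (column_prob X l)^-1 * (X p.1 l * X p.2 l).
  by apply/funext => p; rewrite /scaled_outer mulrC.
have -> : enorm (fun p => (column_prob X l)^-1 * (X p.1 l * X p.2 l)) =
    `|(column_prob X l)^-1| * l2norm (col l X) ^+ 2.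
  rewrite enormZ; congr (_ * _).
  rewrite -[RHS]ger0_norm ?sqr_ge0// -sqrtr_sqr; congr Num.sqrt.
  rewrite -(pair_big xpredT xpredT (fun a b => (X a l * X b l) ^+ 2))/=.
  rewrite (sqr_enorm (fun i => col l X i 0)) expr2 big_distrl/=.
  apply: eq_bigr => a _; rewrite big_distrr/=.
  by apply: eq_bigr => b _; rewrite !mxE exprMn.
rewrite ger0_norm ?invr_ge0 ?(column_prob_is_prob X0).1//.
rewrite /column_prob invf_div.
have [->|c0] := eqVneq (l2norm (col l X) ^+ 2) 0.
  by rewrite mulr0 sqr_ge0.
by rewrite divfK.
Qed.

(** Columns of probability 0 vanish, so the division by 0 loses nothing. *)
Lemma mean_scaled_outer (R : realType) (m n : nat) (X : 'M[R]_(m, n))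
    (p : 'I_m * 'I_m) :
  X != 0 -> \sum_l column_prob X l * scaled_outer X l p = (X *m X^T) p.1 p.2.
Proof.
move=> X0; rewrite mxE; apply: eq_bigr => l _; rewrite mxE /scaled_outer.
have [q0|q0] := eqVneq (column_prob X l) 0; last by rewrite mulrC divfK.
have F0 := frobenius_norm_gt0 X0.
move/eqP: q0; rewrite mulf_eq0 invr_eq0 !sqrf_eq0 (gt_eqF F0) orbF.
move=> /eqP/l2norm_eq0/matrixP/(_ p.1 0); rewrite !mxE => ->.
by rewrite !mul0r mulr0.
Qed.

Lemma frobenius_norm_gram_subsample (R : realType) (m n s : nat)
    (X : 'M[R]_(m, n)) (l0 : 'I_n) (k : seq 'I_n) :
  X != 0 -> size k = s ->
  let S := subsample X (fun t : 'I_s => nth l0 k t) in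
  frobenius_norm (S *m S^T - X *m X^T) =
  deviation (column_prob X) (scaled_outer X) s k.
Proof.
move=> X0 ks S; rewrite frobenius_normE /deviation.
congr enorm; apply/funext => p; rewrite mean_scaled_outer//.
rewrite [LHS]mxE [X in _ + X]mxE; congr (_ - _).
rewrite mxE (big_nth l0) ks big_mkord big_distrl/=; apply: eq_bigr => t _.
rewrite !mxE /scaled_outer; set q := column_prob _ _.
have q0 : 0 <= q by exact: (column_prob_is_prob X0).1.
rewrite mulrACA -invfM -expr2 sqr_sqrtr; last by exact: mulr_ge0 (ler0n _ _) q0.
by rewrite invfM [s%:R^-1 * _]mulrC mulrA.
Qed.

Theorem lemma3 (R : realType) (d : measure_display) (T : measurableType d)
    (P : probability T R) (m n s : nat) (X : 'M[R]_(m, n)) (beta eps : R)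
    (j : 'I_s -> T -> 'I_n) :
  X != 0 ->
  0 < beta <= 1 ->
  0 < eps ->
  (1 <= s < n)%N ->
  let eta : R := 1 + Num.sqrt (8 * ln (1 / beta)) in
  s%:R = eta ^+ 2 * (spectral_norm X ^+ 2 / eps ^+ 2) * num_rank X ^+ 2 ->
  column_sampling P X j ->
  let S (w : T) : 'M[R]_(m, s) := subsample X (fun t => j t w) in
  let err (w : T) : R := `|spectral_norm (S w) - spectral_norm X| in
  ('E_P[err] <= eps%:E)%E /\
  ((1 - beta)%:E <= P [set w | (err w <= eps)%R])%E.
Proof.
move=> X0 beta01 eps0 /andP[s0 sn] eta sE [mj ij qj] S err.
have sigma0 := spectral_norm_gt0 X0.
(* Only a default value for [nth]; samples have size [s]. *)
pose l0 : 'I_n := Ordinal (leq_ltn_trans (leq0n s) sn).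
pose e (k : seq 'I_n) : R := `|spectral_norm
  (subsample X (fun t : 'I_s => nth l0 k t)) - spectral_norm X|.
have errE : err = fun w => e (sample j w).
  apply/funext => w; rewrite /err /S /e.
  by under [in RHS]eq_fun do rewrite -tnth_nth tnth_mktuple.
have e_le k : size k = s ->
    e k <= deviation (column_prob X) (scaled_outer X) s k / spectral_norm X.
  move=> ks; rewrite -(frobenius_norm_gram_subsample l0 X0 ks).
  exact: dist_spectral_norm.
have e_ge0 k : 0 <= e k by exact: normr_ge0.
have sE' : s%:R = (eta * frobenius_norm X ^+ 2 / (eps * spectral_norm X)) ^+ 2.
  rewrite sE /num_rank; field.
  by rewrite (gt_eqF eps0) (gt_eqF sigma0).
have [Ee_le Pe_le] := mean_dominated_error (column_prob_is_prob X0) s0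
  (exprn_gt0 2 (frobenius_norm_gt0 X0)) (fun l => enorm_scaled_outer l X0)
  sigma0 beta01 eps0 sE' e_le.
rewrite errE; split.
  by rewrite (expectation_sample mj ij qj e_ge0) lee_fin.
have i_ge0 (k : seq 'I_n) : 0 <= (e k <= eps)%R%:R :> R by exact: ler0n.
have me := measurable_preimage_sample [set k | (e (tval k) <= eps)%R] mj.
rewrite -[P _](expectation_indic P me).
rewrite (_ : \1_ _ = fun w => (e (sample j w) <= eps)%R%:R).
  by rewrite (expectation_sample mj ij qj i_ge0) lee_fin.
apply/funext => w; rewrite indicE; congr ((nat_of_bool _)%:R);
  apply/idP/idP => [/set_mem//|?]; exact/mem_set.
Qed.
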